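(* Let $\Sigma$ be an alphabet and let $\mathcal{A}$ be any set of seriality axioms and intuitionistic path axioms over $\Sigma$. For every set of formulae $\mathscr{A} \subseteq \mathcal{L}(\Sigma)$ and every formula $A \in \mathcal{L}(\Sigma)$: if $\mathscr{A} \Vdash_{\mathcal{A}}^{\Sigma} A$, then $\mathscr{A} \vdash_{\mathcal{A}}^{\Sigma} A$.
   Context: **Alphabet.** An alphabet $\Sigma$ is a non-empty countable set of characters partitioned as $\Sigma = \Sigma^{+} \cup \Sigma^{-}$, $\Sigma^{+} \cap \Sigma^{-} = \emptyset$, where $\Sigma^{+} = \{a,b,c,\ldots\}$ (forward characters) and $\Sigma^{-} = \{\overline{a},\overline{b},\overline{c},\ldots\}$ (backward characters) have the same cardinality and $a \in \Sigma^{+}$ iff $\overline{a} \in \Sigma^{-}$. The converse operation $\overline{\cdot}$ maps each $a \in \Sigma^{+}$ to $\overline{a} \in \Sigma^{-}$ and vice versa, so $\overline{\overline{x}} = x$ for all $x \in \Sigma$. **Language.** Let $\Phi = \{p,q,r,\ldots\}$ be a denumerable set of propositional atoms. $\mathcal{L}(\Sigma)$ is the set of formulae given by $A ::= p \mid \bot \mid A \lor A \mid A \land A \mid A \supset A \mid \langle x \rangle A \mid [x] A$ with $p \in \Phi$, $x \in \Sigma$. Put ${\sim}A := A \supset \bot$ and $A \supset\subset B := (A \supset B) \land (B \supset A)$. **Axiomatization.** $\mathsf{HIK_m}(\Sigma)$ consists of the following, for each $x \in \Sigma$ (schematic in $A,B$): A0: any axiomatization of intuitionistic propositional logic (including the rule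 modus ponens); A1: $[x](A \supset B) \supset ([x]A \supset [x]B)$; A2: $[x](A \land B) \supset\subset ([x]A \land [x]B)$; A3: $\langle x\rangle(A \lor B) \supset\subset (\langle x\rangle A \lor \langle x\rangle B)$; A4: $[x](A \supset B) \supset (\langle x\rangle A \supset \langle x\rangle B)$; A5: $[x]A \land \langle x\rangle B \supset \langle x\rangle(A \land B)$; A6: ${\sim}\langle x\rangle\bot$; A7: $(A \supset [x]\langle\overline{x}\rangle A) \land (\langle x\rangle[\overline{x}]A \supset A)$; A8: $(\langle x\rangle A \supset [x]B) \supset [x](A \supset B)$; A9: $\langle x\rangle(A \supset B) \supset ([x]A \supset \langle x\rangle B)$; R1: from $A$ infer $[x]A$. The set $\mathcal{A}$ is an arbitrary collection of axioms (schematic in $A$) of the following two forms: seriality axioms $[x]A \supset \langle x\rangle A$ (for some $x\in\Sigma$), and intuitionistic path axioms $(\langle x_1\rangle\cdots\langle x_n\rangle A \supset \langle x\rangle A) \land ([x]A \supset [x_1]\cdots[x_n]A)$ (for some $n \geq 0$ and $x,x_1,\ldots,x_n \in \Sigma$). $\mathsf{HIK_m}(\Sigma,\mathcal{A}) := \mathsf{HIK_m}(\Sigma) \cup \mathcal{A}$, and $\mathsf{IK_m}(\Sigma,\mathcal{A})$ is the smallest set of formulae of $\mathcal{L}(\Sigma)$ containing all substitution instances of the axioms and closed under the inference rules. Write $\vdash_{\mathcal{A}}^{\Sigma} A$ iff $A \in \mathsf{IK_m}(\Sigma,\mathcal{A})$. For a set $\mathscr{A} \subseteq \mathcal{L}(\Sigma)$,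 write $\mathscr{A} \vdash_{\mathcal{A}}^{\Sigma} A$ iff $\vdash_{\mathcal{A}}^{\Sigma} B_1 \land \cdots \land B_n \supset A$ for some $B_1,\ldots,B_n \in \mathscr{A}$ ($n \geq 0$, the empty conjunction being $\bot \supset \bot$). **Models.** A bi-relational $\Sigma$-model is $M = (W, \leq, \{R_x \mid x \in \Sigma\}, V)$ where $W$ is a non-empty set; $\leq$ is a reflexive and transitive relation on $W$; each $R_x \subseteq W \times W$ satisfies: (F1) if $w R_x v$ and $v \leq v'$, then there is $w'$ with $w \leq w'$ and $w' R_x v'$; (F2) if $w \leq w'$ and $w R_x v$, then there is $v'$ with $w' R_x v'$ and $v \leq v'$; (F3) $w R_x u$ iff $u R_{\overline{x}} w$; and $V : W \to 2^{\Phi}$ satisfies: $w \leq u$ implies $V(w) \subseteq V(u)$. A bi-relational $(\Sigma,\mathcal{A})$-model is a bi-relational $\Sigma$-model satisfying the frame condition of each axiom in $\mathcal{A}$: for $[x]A \supset \langle x\rangle A$ the condition is $\forall w \exists u\,(w R_x u)$; for $(\langle x_1\rangle\cdots\langle x_n\rangle A \supset \langle x\rangle A) \land ([x]A \supset [x_1]\cdots[x_n]A)$ it is: for all $w_0,\ldots,w_n$, if $w_0 R_{x_1} w_1, \ldots, w_{n-1} R_{x_n} w_n$, then $w_0 R_x w_n$ (for $n=0$: $w R_x w$ for all $w$). **Satisfaction.** $M,w \Vdash^{\Sigma} p$ iff $p \in V(w)$; $M,w \not\Vdash^{\Sigma} \bot$; $\lor$ and $\land$ are interpreted pointwise as usual;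 $M,w \Vdash^{\Sigma} A \supset B$ iff for all $w' \geq w$, $M,w' \Vdash^{\Sigma} A$ implies $M,w' \Vdash^{\Sigma} B$; $M,w \Vdash^{\Sigma} \langle x\rangle A$ iff there is $v$ with $w R_x v$ and $M,v \Vdash^{\Sigma} A$; $M,w \Vdash^{\Sigma} [x]A$ iff for all $w',v'$, if $w \leq w'$ and $w' R_x v'$, then $M,v' \Vdash^{\Sigma} A$. **Semantic implication.** $\mathscr{A} \Vdash_{\mathcal{A}}^{\Sigma} A$ iff for all bi-relational $(\Sigma,\mathcal{A})$-models $M$ and all worlds $w$ of $M$, if $M,w \Vdash^{\Sigma} B$ for each $B \in \mathscr{A}$, then $M,w \Vdash^{\Sigma} A$. *)

(* Defs.v *)
From Stdlib Require List.
From mathcomp Require Import all_boot.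

Set Implicit Arguments.
Unset Strict Implicit.
Unset Printing Implicit Defensive.

(* [forward] is the partition of the characters into Sigma+ and Sigma-; that
   the two parts have the same cardinality follows from [conv] being an
   involution that exchanges them. *)
Record alphabet := Alphabet {
  letter :> countType;
  forward : pred letter;
  conv : letter -> letter;
  letter_inhabited : inhabited letter;
  convK : involutive conv;
  forward_conv : forall x, forward (conv x) = ~~ forward x }.

(* The denumerable set of propositional atoms is nat. *)
Inductive formula (Sigma : alphabet) : Type :=
  | Atom of nat
  | Bot
  | Or of formula Sigma & formula Sigma
  | And of formula Sigma & formula Sigma
  | Imp of formula Sigma & formula Sigma
  | Dia of Sigma & formula Sigma
  | Box of Sigma & formula Sigma.

Arguments Atom {Sigma} p.
Arguments Bot {Sigma}.

Declare Scope modal_scope.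
Delimit Scope modal_scope with M.
Bind Scope modal_scope with formula.

Notation "A ∧ B" := (And A B) (at level 80, right associativity) : modal_scope.
Notation "A ∨ B" := (Or A B) (at level 85, right associativity) : modal_scope.
Notation "A ⊃ B" := (Imp A B) (at level 90, right associativity) : modal_scope.
Notation "◇[ x ] A" := (Dia x A)
  (at level 35, A at level 35, format "◇[ x ] A") : modal_scope.
Notation "□[ x ] A" := (Box x A)
  (at level 35, A at level 35, format "□[ x ] A") : modal_scope.

Local Open Scope modal_scope.

Definition Neg (Sigma : alphabet) (A : formula Sigma) := A ⊃ Bot.

Definition Iff (Sigma : alphabet) (A B : formula Sigma) := (A ⊃ B) ∧ (B ⊃ A).

(* [Seriality x] is the schema [x]A ⊃ <x>A, and [Path [:: x1; ...; xn] x] the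
   schema (<x1>...<xn>A ⊃ <x>A) ∧ ([x]A ⊃ [x1]...[xn]A). *)
Inductive extra_axiom (Sigma : alphabet) : Type :=
  | Seriality of Sigma
  | Path of seq Sigma & Sigma.

Definition axiom_instance (Sigma : alphabet) (a : extra_axiom Sigma)
    (A : formula Sigma) : formula Sigma :=
  match a with
  | Seriality x => □[x] A ⊃ ◇[x] A
  | Path xs x => (foldr (@Dia Sigma) A xs ⊃ ◇[x] A) ∧
                 (□[x] A ⊃ foldr (@Box Sigma) A xs)
  end.

Inductive provable (Sigma : alphabet) (Ax : extra_axiom Sigma -> Prop) :
    formula Sigma -> Prop :=
  (* A0: a Hilbert system for intuitionistic propositional logic *)
  | IPL_K A B : provable Ax (A ⊃ B ⊃ A)
  | IPL_S A B C : provable Ax ((A ⊃ B ⊃ C) ⊃ (A ⊃ B) ⊃ A ⊃ C)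
  | IPL_andI A B : provable Ax (A ⊃ B ⊃ A ∧ B)
  | IPL_andEl A B : provable Ax (A ∧ B ⊃ A)
  | IPL_andEr A B : provable Ax (A ∧ B ⊃ B)
  | IPL_orIl A B : provable Ax (A ⊃ A ∨ B)
  | IPL_orIr A B : provable Ax (B ⊃ A ∨ B)
  | IPL_orE A B C : provable Ax ((A ⊃ C) ⊃ (B ⊃ C) ⊃ A ∨ B ⊃ C)
  | IPL_botE A : provable Ax (Bot ⊃ A)
  | MP A B : provable Ax (A ⊃ B) -> provable Ax A -> provable Ax B
  | A1 x A B : provable Ax (□[x] (A ⊃ B) ⊃ (□[x] A ⊃ □[x] B))
  | A2 x A B : provable Ax (Iff (□[x] (A ∧ B)) (□[x] A ∧ □[x] B))
  | A3 x A B : provable Ax (Iff (◇[x] (A ∨ B)) (◇[x] A ∨ ◇[x] B))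
  | A4 x A B : provable Ax (□[x] (A ⊃ B) ⊃ (◇[x] A ⊃ ◇[x] B))
  | A5 x A B : provable Ax (□[x] A ∧ ◇[x] B ⊃ ◇[x] (A ∧ B))
  | A6 x : provable Ax (Neg (◇[x] Bot))
  | A7 x A :
      provable Ax ((A ⊃ □[x] ◇[conv x] A) ∧ (◇[x] □[conv x] A ⊃ A))
  | A8 x A B : provable Ax ((◇[x] A ⊃ □[x] B) ⊃ □[x] (A ⊃ B))
  | A9 x A B : provable Ax (◇[x] (A ⊃ B) ⊃ (□[x] A ⊃ ◇[x] B))
  | R1 x A : provable Ax A -> provable Ax (□[x] A)
  | Extra a A : Ax a -> provable Ax (axiom_instance a A).

(* B1 ∧ ... ∧ Bn, associated to the left. *)
Definition conjunction (Sigma : alphabet) (Bs : seq (formula Sigma)) :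
    formula Sigma :=
  match Bs with
  | [::] => Bot ⊃ Bot
  | B :: Bs' => foldl (@And Sigma) B Bs'
  end.

Definition derivable (Sigma : alphabet) (Ax : extra_axiom Sigma -> Prop)
    (Gamma : formula Sigma -> Prop) (A : formula Sigma) : Prop :=
  exists Bs : seq (formula Sigma),
    List.Forall Gamma Bs /\ provable Ax (conjunction Bs ⊃ A).

Record model (Sigma : alphabet) := Model {
  world :> Type;
  wle : world -> world -> Prop;
  R : Sigma -> world -> world -> Prop;
  V : world -> nat -> Prop;
  world_inhabited : inhabited world;
  wle_refl : forall w, wle w w;
  wle_trans : forall w u v, wle w u -> wle u v -> wle w v;
  F1 : forall x w v v', R x w v -> wle v v' ->
         exists w', wle w w' /\ R x w' v';
  F2 : forall x w w' v, wle w w' -> R x w v ->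
         exists v', R x w' v' /\ wle v v';
  F3 : forall x w u, R x w u <-> R (conv x) u w;
  V_mono : forall w u, wle w u -> forall p, V w p -> V u p }.

(* In the path condition only w 0, ..., w n matter, n being the length of xs;
   the default value of [nth] is never reached. *)
Definition frame_condition (Sigma : alphabet) (M : model Sigma)
    (a : extra_axiom Sigma) : Prop :=
  match a with
  | Seriality x => forall w : M, exists u : M, R x w u
  | Path xs x => forall w : nat -> M,
      (forall i : nat, i < size xs -> R (nth x xs i) (w i) (w i.+1)) ->
      R x (w 0) (w (size xs))
  end.

Definition Ax_model (Sigma : alphabet) (Ax : extra_axiom Sigma -> Prop)
    (M : model Sigma) : Prop :=
  forall a, Ax a -> frame_condition M a.

Fixpoint sat (Sigma : alphabet) (M : model Sigma) (w : M) (A : formula Sigma)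
    {struct A} : Prop :=
  match A with
  | Atom p => V w p
  | Bot => False
  | Or B C => sat w B \/ sat w C
  | And B C => sat w B /\ sat w C
  | Imp B C => forall w' : M, wle w w' -> sat w' B -> sat w' C
  | Dia x B => exists v : M, R x w v /\ sat v B
  | Box x B => forall w' v' : M, wle w w' -> R x w' v' -> sat v' B
  end.

Definition entails (Sigma : alphabet) (Ax : extra_axiom Sigma -> Prop)
    (Gamma : formula Sigma -> Prop) (A : formula Sigma) : Prop :=
  forall M : model Sigma, Ax_model Ax M ->
    forall w : M, (forall B, Gamma B -> sat w B) -> sat w A.

(* Main.v *)
(** Worlds of the canonical model are the prime theories, ordered by inclusion,
    with [w R_x v] iff [[x]A ∈ w] implies [A ∈ v] and [A ∈ v] implies
    [<x>A ∈ w].  Axiom A7 makes this relation compatible with the converse, so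
    that F1 reduces to F2, and the path axioms say exactly that the path
    conditions hold.  All worlds are obtained from one prime extension lemma: a
    set whose consequences avoid a set closed under disjunction extends to a
    prime theory avoiding it.  Existence of [R_x]-successors (F2, truth of
    diamonds, seriality) comes from A9 and A3, existence of [R_x]-predecessors
    above a given world (truth of boxes) from A8. *)

Require Import Defs.
From Stdlib Require List.
From mathcomp Require Import all_boot boolp classical_sets.

Set Implicit Arguments.
Unset Strict Implicit.
Unset Printing Implicit Defensive.

Local Open Scope modal_scope.

Section Canonical.

Variables (Sigma : alphabet) (Ax : extra_axiom Sigma -> Prop).

Implicit Types (A B C D : formula Sigma) (G H I : formula Sigma -> Prop).
Implicit Types (x : Sigma).

(** * Derivability from hypotheses *)

Local Notation "⊢ A" := (provable Ax A%M) (at level 95).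

(* R1 is deliberately absent: necessitation applies to theorems only, which
   makes the deduction theorem immediate. *)
Inductive der G : formula Sigma -> Prop :=
  | der_hyp A : G A -> der G A
  | der_thm A : (⊢ A) -> der G A
  | der_mp A B : der G (A ⊃ B) -> der G A -> der G B.

Definition adjoin G A : formula Sigma -> Prop := fun B => G B \/ B = A.

Lemma der_mono G H A : (forall B, G B -> H B) -> der G A -> der H A.
Proof.
move=> GH; elim=> [B /GH|B|B C _ ? _ ?]; [exact: der_hyp|exact: der_thm|].
exact: (@der_mp _ B).
Qed.

Lemma der_cut G H A : (forall B, G B -> der H B) -> der G A -> der H A.
Proof.
move=> GH; elim=> [B /GH //|B|B C _ ? _ ?]; [exact: der_thm|].
exact: (@der_mp _ B).
Qed.

Lemma der_ax G A B : (⊢ A ⊃ B) -> der G A -> der G B.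
Proof. by move=> AtoB; apply: der_mp; apply: der_thm. Qed.

Lemma der_imp G A B : der (adjoin G A) B -> der G (A ⊃ B).
Proof.
elim=> [C [GC | ->]|C pC|C D _ ? _ ?].
- by apply: der_ax (der_hyp GC); apply: IPL_K.
- apply: der_thm; apply: MP (MP (IPL_S Ax A (A ⊃ A) A) _) _; exact: IPL_K.
- by apply: der_thm; apply: MP pC; apply: IPL_K.
- by apply: (@der_mp _ (A ⊃ C)) => //; apply: der_ax; first exact: IPL_S.
Qed.

Lemma der_adjoin G A : der (adjoin G A) A.
Proof. by apply: der_hyp; right. Qed.

Lemma der_weak G A B : der G B -> der (adjoin G A) B.
Proof. by apply: der_mono => C; left. Qed.

Lemma der_or G A B C :
  der (adjoin G A) C -> der (adjoin G B) C -> der G (A ∨ B) -> der G C.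
Proof.
move=> /der_imp dA /der_imp dB.
apply: der_mp; apply: der_mp dB; apply: der_mp dA.
exact/der_thm/IPL_orE.
Qed.

Lemma der_and G A B : der G A -> der G B -> der G (A ∧ B).
Proof. by move=> dA; apply: der_mp; apply: der_ax dA; apply: IPL_andI. Qed.

Lemma der_provable A : der (fun=> False) A -> ⊢ A.
Proof. by elim=> [B []|//|B C _ ? _ ?]; apply: (@MP _ _ B). Qed.

Lemma provable_imp A B : der (adjoin (fun=> False) A) B -> ⊢ A ⊃ B.
Proof. by move/der_imp/der_provable. Qed.

Lemma provable_imp_id A : ⊢ A ⊃ A.
Proof. exact/provable_imp/der_adjoin. Qed.

Lemma provable_or_elim A B C : (⊢ A ⊃ C) -> (⊢ B ⊃ C) -> ⊢ A ∨ B ⊃ C.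
Proof. by move=> AtoC; apply: MP; apply: MP AtoC; apply: IPL_orE. Qed.

Lemma provable_imp_trans A B C : (⊢ A ⊃ B) -> (⊢ B ⊃ C) -> ⊢ A ⊃ C.
Proof.
move=> AtoB BtoC; apply: provable_imp.
exact: der_ax BtoC (der_ax AtoB (der_adjoin _ _)).
Qed.

Lemma box_mono x A B : (⊢ A ⊃ B) -> ⊢ □[x] A ⊃ □[x] B.
Proof. by move=> AtoB; apply: MP (A1 _ _ _ _) _; apply: R1. Qed.

Lemma dia_mono x A B : (⊢ A ⊃ B) -> ⊢ ◇[x] A ⊃ ◇[x] B.
Proof. by move=> AtoB; apply: MP (A4 _ _ _ _) _; apply: R1. Qed.

Lemma provable_conjunction Bs B : List.In B Bs -> ⊢ conjunction Bs ⊃ B.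
Proof.
case: Bs => [[]|C Bs] /= inB.
(* The fold nests to the left, so the induction generalizes its accumulator [E]. *)
have foldlP Cs E : (⊢ foldl (@And Sigma) E Cs ⊃ E) /\
    forall D, List.In D Cs -> ⊢ foldl (@And Sigma) E Cs ⊃ D.
  elim: Cs E => [|D Cs IH] E /=; first by split=> //; apply: provable_imp_id.
  have [IH1 IH2] := IH (E ∧ D)%M.
  split=> [|F [<-|/IH2 //]]; apply: provable_imp_trans IH1 _.
    exact: IPL_andEl.
  exact: IPL_andEr.
by have [h1 h2] := foldlP Bs C; case: inB => [<-|/h2].
Qed.

(** A derivation is finite, so the hypotheses it uses can be collected into a list. *)
Lemma der_derivable G A : der G A -> derivable Ax G A.
Proof.
move=> dA; have [Bs [GBs]] : exists Bs,
    List.Forall G Bs /\ der (fun B => List.In B Bs) A.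
  elim: dA => [B GB|B pB|B C _ [Bs [GBs dBs]] _ [Cs [GCs dCs]]].
  - exists [:: B]; split; first by constructor.
    by apply: der_hyp; left.
  - by exists [::]; split; [constructor|apply: der_thm].
  - exists (Bs ++ Cs); split; first exact/List.Forall_app.
    apply: der_mp (der_mono _ dBs) (der_mono _ dCs) => D ?;
      apply/List.in_app_iff; by [left|right].
move=> dBs; exists Bs; split=> //; apply/provable_imp/(der_cut _ dBs) => B inB.
exact: der_ax (provable_conjunction inB) (der_adjoin _ _).
Qed.

(** * Prime theories and their existence *)

Definition prime_theory G : Prop :=
  [/\ forall A, der G A -> G A, ~ G Bot & forall A B, G (A ∨ B) -> G A \/ G B].

(** Zorn's lemma gives a maximal [P]. If [P] contains [A ∨ B] but neither disjunct, adjoining either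
    one derives a member of [I]; by cases, [P] derives the disjunction of these two members, which
    is again in [I]. *)
Lemma prime_extension G I :
    I Bot -> (forall A B, I A -> I B -> I (A ∨ B)) ->
    (forall A, der G A -> ~ I A) ->
  exists P, [/\ prime_theory P, forall A, G A -> P A & forall A, P A -> ~ I A].
Proof.
move=> I0 IU GI.
(* [G] is kept apart from [X], so that the union of the empty chain qualifies too. *)
pose avoids (X : set (formula Sigma)) :=
  forall D, der (fun B => G B \/ X B) D -> ~ I D.
have [F avF chF|P [avP maxP]] := @Zorn_bigcup _ avoids.
  (* Hypotheses drawn from two members of the chain lie together in the larger one. *)
  move=> D dD; have : der G D \/ exists2 X, F X & der (fun B => G B \/ X B) D.
    elim: dD => [B [GB|[X FX XB]]|B pB|B C _ IHBC _ IHB].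
    - by left; apply: der_hyp.
    - by right; exists X => //; apply: der_hyp; right.
    - by left; apply: der_thm.
    - case: IHBC IHB => [dBC|[X FX dBC]] [dB|[Y FY dB]].
      + by left; apply: der_mp dB.
      + right; exists Y => //; apply: der_mp dB; apply: der_mono dBC; by left.
      + right; exists X => //; apply: der_mp dBC _; apply: der_mono dB; by left.
      + right; have [XY|YX] := chF _ _ FX FY.
          exists Y => //; apply: der_mp dB; apply: der_mono dBC => E.
          by case=> [|/XY]; [left|right].
        exists X => //; apply: der_mp dBC _; apply: der_mono dB => E.
        by case=> [|/YX]; [left|right].
  by case=> [/GI //|[X /avF avX /avX]].
have maxE A : (forall D, der (adjoin (fun B => G B \/ P B) A) D -> ~ I D) -> P A.
  move=> avA; apply: contrapT => nPA; apply: (maxP (adjoin P A)).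
    split=> [E PE|/(_ A) sub]; first by left.
    by apply: nPA; apply: sub; right.
  move=> D dD; apply: avA; apply: der_mono dD => B.
  by case=> [?|[?|->]]; [left; left|left; right|right].
have cutE A D : der (fun B => G B \/ P B) A ->
    der (adjoin (fun B => G B \/ P B) A) D -> der (fun B => G B \/ P B) D.
  by move=> dA /der_imp dAD; apply: der_mp dA.
have GP A : G A -> P A.
  move=> GA; apply: maxE => D /cutE dD; apply/avP/dD.
  by apply: der_hyp; left.
have closedP A : der P A -> P A.
  move=> dA; apply: maxE => D /cutE dD; apply/avP/dD.
  by apply: der_mono dA; right.
have disjP A : P A -> ~ I A by move=> PA; apply: avP; apply: der_hyp; right.
exists P; split=> //; split=> //; first by move/disjP.
move=> A B PAB; apply: contrapT => /not_orP [nPA nPB].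
have refute C : ~ P C -> exists2 D, I D & der (adjoin P C) D.
  move=> nPC; apply: contrapT => noD; apply: nPC; apply: maxE => D dD ID.
  apply: noD; exists D => //; apply: der_mono dD => E.
  by case=> [[/GP|]|]; [left|left|right].
have [[D ID dD] [E IE dE]] := (refute A nPA, refute B nPB).
apply: (disjP (D ∨ E)%M); last exact: IU.
apply: closedP; apply: der_or (der_hyp PAB).
  exact: der_ax (IPL_orIl _ _ _) dD.
exact: der_ax (IPL_orIr _ _ _) dE.
Qed.

(** The set to avoid consists of all formulas that provably imply [A]. *)
Lemma prime_separation G A : ~ der G A ->
  exists P, [/\ prime_theory P, forall B, G B -> P B & ~ P A].
Proof.
move=> nGA; have [|B C||P [primeP GP PI]] :=
  @prime_extension G (fun B => ⊢ B ⊃ A).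
- exact: IPL_botE.
- exact: provable_or_elim.
- by move=> B dB BA; apply: nGA; apply: der_ax dB.
- by exists P; split=> // /PI; apply; apply: provable_imp_id.
Qed.

Section PrimeTheory.

Variables (w : formula Sigma -> Prop) (prime_w : prime_theory w).

Lemma prime_closed A : der w A -> w A.
Proof. by case: prime_w => cl _ _; apply: cl. Qed.

Lemma prime_thm A : (⊢ A) -> w A.
Proof. by move=> pA; apply/prime_closed/der_thm. Qed.

Lemma prime_mp A B : w (A ⊃ B) -> w A -> w B.
Proof.
by move=> wAB wA; apply: prime_closed; apply: der_mp (der_hyp wAB) (der_hyp wA).
Qed.

Lemma prime_imp A B : (⊢ A ⊃ B) -> w A -> w B.
Proof. by move/prime_thm; apply: prime_mp. Qed.

Lemma prime_and A B : w (A ∧ B) <-> w A /\ w B.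
Proof.
split=> [wAB|[wA wB]].
  by split; apply: prime_imp wAB; [apply: IPL_andEl|apply: IPL_andEr].
by apply: prime_closed; apply: der_and; apply: der_hyp.
Qed.

Lemma prime_or A B : w (A ∨ B) <-> w A \/ w B.
Proof.
split; first by case: prime_w => _ _; apply.
by case; apply: prime_imp; [apply: IPL_orIl|apply: IPL_orIr].
Qed.

Lemma prime_bot : ~ w Bot.
Proof. by case: prime_w. Qed.

(** The derivation is replayed under the box, by R1 for theorems and A1 for modus ponens. *)
Lemma prime_box_closed x A : der (fun B => w (□[x] B)) A -> w (□[x] A).
Proof.
elim=> [//|B pB|B C _ wBC _ wB]; first exact/prime_thm/R1.
by apply: prime_mp wB; apply: prime_imp wBC; apply: A1.
Qed.

End PrimeTheory.

(** * The canonical accessibility relations *)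

Definition canonical_rel x (w v : formula Sigma -> Prop) : Prop :=
  (forall A, w (□[x] A) -> v A) /\ (forall A, v A -> w (◇[x] A)).

(** Each half of A7 yields one half of the converse relation. *)
Lemma canonical_rel_conv x w v : prime_theory w -> prime_theory v ->
  canonical_rel x w v -> canonical_rel (conv x) v w.
Proof.
move=> pw pv [wv vw]; split=> A.
  by move/vw; apply: prime_imp => //; apply: MP (IPL_andEr _ _ _) (A7 _ _ _).
move=> wA; apply: wv; apply: prime_imp wA => //.
exact: MP (IPL_andEl _ _ _) (A7 _ _ _).
Qed.

(** Extend [G] and all [B] with [□[x] B] in [w], avoiding every [D] with [◇[x] D] not in [w]; A3
    closes the avoided set under disjunction. *)
Lemma canonical_successor x w G : prime_theory w ->
    (forall A, der G A -> w (◇[x] A)) ->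
  exists v, [/\ prime_theory v, forall A, G A -> v A & canonical_rel x w v].
Proof.
move=> pw Gw.
(* A2 merges the boxed hypotheses used into a single [B], as A9 requires. *)
have boxed D : der (fun B => G B \/ w (□[x] B)) D ->
    exists2 B, w (□[x] B) & der G (B ⊃ D).
  have wT : w (□[x] (Bot ⊃ Bot)) by apply/(prime_thm pw)/R1/IPL_botE.
  elim=> [B [GB|wB]|B pB|B C _ [E wE dE] _ [F wF dF]].
  - by exists (Bot ⊃ Bot)%M => //; apply/der_imp/der_weak/der_hyp.
  - by exists B => //; apply/der_thm/provable_imp_id.
  - by exists (Bot ⊃ Bot)%M => //; apply/der_imp/der_thm.
  - exists (E ∧ F)%M.
      apply: prime_imp (MP (IPL_andEr _ _ _) (A2 _ x E F)) _ => //.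
      exact/prime_and.
    have dEF := der_adjoin G (E ∧ F)%M.
    apply: der_imp; apply: (@der_mp _ B).
      exact: der_mp (der_weak _ dE) (der_ax (IPL_andEl _ _ _) dEF).
    exact: der_mp (der_weak _ dF) (der_ax (IPL_andEr _ _ _) dEF).
have [|A B nA nB|D|v [pv Gv vI]] :=
    @prime_extension (fun B => G B \/ w (□[x] B)) (fun D => ~ w (◇[x] D)).
- by move=> /(prime_imp pw (A6 _ x)) /(prime_bot pw).
- move=> /(prime_imp pw (MP (IPL_andEl _ _ _) (A3 _ x A B))).
  by move=> /(prime_or pw) [].
- move=> /boxed [B wB dBD]; apply; apply: prime_mp wB => //.
  by apply: prime_imp (Gw _ dBD) => //; apply: A9.
- exists v; split=> //; first by move=> A GA; apply: Gv; left.
  split=> A; first by move=> wA; apply: Gv; right.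
  by move/vI/contrapT.
Qed.

(** Extend [w] and all [◇[x] B] with [B] in [v], avoiding whatever implies some [□[x] C] with [C]
    not in [v]. Passing to formulas that imply such a box makes the avoided set closed under
    disjunction, as [v] is prime. *)
Lemma canonical_predecessor x w v : prime_theory w -> prime_theory v ->
    (forall A, w (□[x] A) -> v A) ->
  exists w', [/\ prime_theory w', forall A, w A -> w' A & canonical_rel x w' v].
Proof.
move=> pw pv wv.
pose T D := w D \/ exists2 B, v B & D = (◇[x] B)%M.
(* One diamond, of the conjunction of the arguments, implies all the diamonds used. *)
have guarded D : der T D -> exists2 B, v B & w (◇[x] B ⊃ D).
  have vT : v (Bot ⊃ Bot) by apply/(prime_thm pv)/IPL_botE.
  elim=> [B [wB|[C vC ->]]|B pB|B C _ [E vE wE] _ [F vF wF]].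
  - exists (Bot ⊃ Bot)%M => //; apply: prime_closed => //.
    exact/der_imp/der_weak/der_hyp.
  - by exists C => //; apply/(prime_thm pw)/provable_imp_id.
  - exists (Bot ⊃ Bot)%M => //; apply: prime_closed => //.
    exact/der_imp/der_thm.
  - exists (E ∧ F)%M; first exact/prime_and.
    have dEF := der_adjoin w (◇[x] (E ∧ F))%M.
    apply: prime_closed => //; apply: der_imp; apply: (@der_mp _ B).
      apply: der_mp (der_weak _ (der_hyp wE)) _.
      exact: der_ax (dia_mono _ (IPL_andEl _ _ _)) dEF.
    apply: der_mp (der_weak _ (der_hyp wF)) _.
    exact: der_ax (dia_mono _ (IPL_andEr _ _ _)) dEF.
have [|A B|D|w' [pw' Tw' wI]] :=
    @prime_extension T (fun D => exists2 C, ~ v C & ⊢ D ⊃ □[x] C).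
- exists Bot; [exact: prime_bot|exact: IPL_botE].
- move=> [C nC AtoC] [E nE BtoE]; exists (C ∨ E)%M;
    first by move/(prime_or pv)=> [].
  apply: provable_or_elim; [apply: provable_imp_trans AtoC _|
    apply: provable_imp_trans BtoE _]; apply: box_mono.
    exact: IPL_orIl.
  exact: IPL_orIr.
(* A8 turns [◇[x] B ⊃ □[x] C] in [w] into [□[x] (B ⊃ C)], which forces [C] into [v]. *)
- move=> /guarded [B vB wBD] [C nC DC]; apply: nC; apply: prime_mp vB => //.
  apply: wv; apply: prime_imp (A8 _ _ _ _) _ => //.
  apply: prime_closed => //; apply: der_imp; apply: der_ax DC _.
  exact: der_mp (der_weak _ (der_hyp wBD)) (der_adjoin _ _).
- exists w'; split=> //; first by move=> A wA; apply: Tw'; left.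
  split=> A.
    move=> w'A; apply: contrapT => nA; apply: (wI _ w'A).
    by exists A => //; apply: provable_imp_id.
  by move=> vA; apply: Tw'; right; exists A.
Qed.

Lemma canonical_F2 x w w' v : prime_theory w -> prime_theory w' ->
    prime_theory v -> (forall A, w A -> w' A) -> canonical_rel x w v ->
  exists v', [/\ prime_theory v', canonical_rel x w' v' & forall A, v A -> v' A].
Proof.
move=> pw pw' pv ww' [_ vw].
have [A /(prime_closed pv) /vw /ww' //|v' [? ? ?]] :=
  @canonical_successor x w' v pw'.
by exists v'.
Qed.

(** * The canonical model *)

Definition canonical_world := {w | prime_theory w}.

Definition canonical_model (w0 : canonical_world) : model Sigma.
Proof.
refine (@Model Sigma canonical_world
  (fun w v => forall A, proj1_sig w A -> proj1_sig v A)
  (fun x w v => canonical_rel x (proj1_sig w) (proj1_sig v))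
  (fun w p => proj1_sig w (Atom p)) (inhabits w0) _ _ _ _ _ _).
- by [].
- by move=> w u v wu uv A /wu /uv.
(* F1 for [x] is F2 for [conv x], read from [v] to [w]. *)
- move=> x [w pw] [v pv] [v' pv'] /= /(canonical_rel_conv pw pv) vw vv'.
  have [w' [pw' v'w' ww']] := canonical_F2 pv pv' pw vv' vw.
  exists (exist _ w' pw'); split=> //=; rewrite -[x]convK.
  exact: canonical_rel_conv.
- move=> x [w pw] [w' pw'] [v pv] /= ww' wv.
  have [v' [pv' ? ?]] := canonical_F2 pw pw' pv ww' wv.
  by exists (exist _ v' pv').
- move=> x [w pw] [v pv] /=; split; first exact: canonical_rel_conv.
  by move/(canonical_rel_conv pv pw); rewrite convK.
- by move=> w u wu p /wu.
Defined.

Lemma canonical_Ax_model w0 : Ax_model Ax (canonical_model w0).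
Proof.
case=> [x|xs x] axm /=.
  (* Consequences of no hypotheses are theorems: R1 boxes them and seriality makes them diamonds. *)
  case=> w pw; have [A dA|v [pv _ wv]] := @canonical_successor x w (fun=> False) pw.
    apply: prime_imp (Extra A axm) _ => //.
    exact/(prime_thm pw)/R1/der_provable.
  by exists (exist _ v pv).
move=> w; have pw i : prime_theory (proj1_sig (w i)) := proj2_sig (w i).
move=> wR.
(* Diamonds travel back to the start of the path and boxes forward to its end. The tail starts at
   [w 1], so the induction generalizes [w]. *)
have path A : (proj1_sig (w (size xs)) A ->
      proj1_sig (w 0) (foldr (@Dia Sigma) A xs)) /\
    (proj1_sig (w 0) (foldr (@Box Sigma) A xs) ->
      proj1_sig (w (size xs)) A).
  move: {pw axm} w wR; elim: xs => [|y ys IH] w wR //=.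
  have [IHd IHb] := IH (fun i => w i.+1) (fun i => wR i.+1).
  have [box dia] := wR 0 isT.
  by split=> [/IHd /dia|/box /IHb].
have ax A := Extra A axm.
split=> A.
  move=> wA; apply/(path A).2; apply: prime_imp wA => //.
  exact: MP (IPL_andEr _ _ _) (ax A).
move=> /(path A).1; apply: prime_imp => //.
exact: MP (IPL_andEl _ _ _) (ax A).
Qed.

(** * Truth lemma and completeness *)

Lemma truth_lemma w0 A (w : canonical_model w0) :
  sat w A <-> proj1_sig w A.
Proof.
elim: A w => [p||A IHA B IHB|A IHA B IHB|A IHA B IHB|x A IHA|x A IHA] w /=;
  have pw := proj2_sig w.
- by [].
- by split=> // /(prime_bot pw).
- by rewrite IHA IHB (prime_or pw).
- by rewrite IHA IHB (prime_and pw).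
- split=> [wAB|wAB w' ww' /IHA w'A]; last first.
    by apply/IHB; apply: (prime_mp (proj2_sig w')) w'A; apply: ww'.
  (* By the deduction theorem, [w] with [A] adjoined does not derive [B]. *)
  apply: contrapT => nAB.
  have [/der_imp /(prime_closed pw) //|v [pv wv nB]] :=
    @prime_separation (adjoin (proj1_sig w) A) B.
  apply/nB/(IHB (exist _ v pv))/wAB; last by apply/IHA/wv; right.
  by move=> C wC; apply: wv; left.
- split=> [[v [[_ vw] /IHA]]|wA]; first exact: vw.
  have [B|v [pv Av wv]] := @canonical_successor x _ (adjoin (fun=> False) A) pw.
    by move/provable_imp/(dia_mono x) => AtoB; apply: prime_imp wA.
  by exists (exist _ v pv); split=> //; apply/IHA/Av; right.
- split=> [wA|wA w' v' ww' [w'v' _]]; last by apply/IHA/w'v'/ww'.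
  (* A prime [v] containing all unboxed formulas of [w] may fail to be a successor of [w], but it is
     one of some [w'] above [w]. *)
  apply: contrapT => nA.
  have [/(prime_box_closed pw) //|v [pv wv nvA]] :=
    @prime_separation (fun B => proj1_sig w (□[x] B)) A.
  have [w' [pw' ww' w'v]] := canonical_predecessor pw pv wv.
  by apply/nvA/(IHA (exist _ v pv))/(wA (exist _ w' pw')).
Qed.

End Canonical.

Theorem theorem2 (Sigma : alphabet) (Ax : extra_axiom Sigma -> Prop)
    (Gamma : formula Sigma -> Prop) (A : formula Sigma) :
  entails Ax Gamma A -> derivable Ax Gamma A.
Proof.
move=> GA; apply: der_derivable; apply: contrapT => nGA.
(* As a world of the canonical model, [P] satisfies [Gamma] and refutes [A]. *)
have [P [pP GP nPA]] := prime_separation nGA.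
pose w : canonical_world Ax := exist _ P pP.
apply: nPA; apply/(@truth_lemma _ _ w A w).
apply: GA => [|B GB]; first exact: canonical_Ax_model.
exact/truth_lemma/GP.
Qed.
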